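(* Let $n\ge2$. A positive integer vector $(f_1,\dots,f_n)$ is the minor-order exponent profile of an $n\times n$ oscillatory matrix if and only if $f_n=1$ and there exist $Q_+,Q_-\in\mathcal{W}_n$ such that $$f_k=\max\{t_k(Q_+),t_k(Q_-)\},\qquad 1\le k<n.$$
   Context: All matrices are real. A matrix is totally nonnegative (TN) if all its minors are $\ge0$ and totally positive (TP) if all its minors are $>0$; a square TN matrix is oscillatory if some positive power of it is TP. For an $n\times n$ oscillatory matrix $A$ and $1\le k\le n$, $e_k(A)=\min\{m\ge1:\text{all minors of order }k\text{ of }A^m\text{ are positive}\}$; the minor-order exponent profile of $A$ is $(e_1(A),\dots,e_n(A))$. For $a\in\{1,\dots,n-1\}$ and $I\subseteq\{1,\dots,n\}$, let $c_a^+(I)=(I\setminus\{a\})\cup\{a+1\}$ if $a\in I$ and $a+1\notin I$, and $c_a^+(I)=I$ otherwise. For a finite sequence $Q=(q_1,\dots,q_\ell)$ in $\{1,\dots,n-1\}$, a $Q$-pass applies $c_{q_1}^+,\dots,c_{q_\ell}^+$ successively, in that order ($c_{q_1}^+$ first). With $L_k=\{1,\dots,k\}$ and $R_k=\{n-k+1,\dots,n\}$, $t_k(Q)$ is the least number $m\ge1$ of repeated $Q$-passes carrying $L_k$ to $R_k$ ($\infty$ if this never occurs). $Q$ is complete if every element of $\{1,\dots,n-1\}$ occurs in it. $\Omega_n$ is the word obtained by concatenating the blocks $(n-1),(n-2,n-1),\dots,(1,2,\dots,n-1)$ in this order, and $\mathcal{W}_n$ is the (finite) set of complete subwords (subsequences)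 of $\Omega_n$. *)

(* Defs.v *)
From mathcomp Require Import all_boot all_order all_algebra.
From mathcomp Require Import finmap boolp reals.

Set Implicit Arguments.
Unset Strict Implicit.
Unset Printing Implicit Defensive.

Import Order.TTheory GRing.Theory Num.Theory.

Local Open Scope ring_scope.

(* Minima of sets of naturals take values in [option nat], where [None] stands
   for infinity, the minimum of the empty set. *)
Definition least (P : nat -> Prop) : option nat :=
  if pselect (exists m, `[< P m >]) is left exP then Some (ex_minn exP)
  else None.

Lemma leastP (P : nat -> Prop) m :
  least P = Some m <-> P m /\ (forall m', P m' -> (m <= m')%N).
Proof.
rewrite /least; case: pselect => [exP|nexP]; last first.
  by split=> // -[Pm _]; case: nexP; exists m; apply/asboolP.
case: ex_minnP => p /asboolP Pp minp; split=> [[<-]|[Pm minm]].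
  by split=> // m' Pm'; apply/minp/asboolP.
congr Some; apply/eqP; rewrite eqn_leq minm // andbT.
exact/minp/asboolP.
Qed.

Definition omax (x y : option nat) : option nat :=
  if (x, y) is (Some a, Some b) then Some (maxn a b) else None.

Section Matrices.
Variables (R : realType) (n : nat).
Implicit Types A : 'M[R]_n.

(* A minor of order k is indexed by its increasing sequences of k row indices
   and k column indices; there is none for k > n, and the one for k = 0 is 1. *)
Definition all_minors (P : R -> Prop) (k : nat) A : Prop :=
  forall f g : 'I_k -> 'I_n,
    {homo f : i j / (i < j)%N} -> {homo g : i j / (i < j)%N} ->
    P (\det (mxsub f g A)).

Definition minors_ge0 := all_minors (fun x => 0 <= x).
Definition minors_gt0 := all_minors (fun x => 0 < x).

Definition totally_nonnegative A : Prop := forall k, minors_ge0 k A.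
Definition totally_positive A : Prop := forall k, minors_gt0 k A.

Definition oscillatory A : Prop :=
  totally_nonnegative A /\
  exists m : nat, (0 < m)%N /\ totally_positive (A ^+ m).

Definition minor_exponent (k : nat) A : option nat :=
  least (fun m => (0 < m)%N /\ minors_gt0 k (A ^+ m)).

(* The i-th entry (i < n) of the vector f is the one attached to order i + 1. *)
Definition is_exponent_profile (f : 'I_n -> nat) A : Prop :=
  forall i : 'I_n, minor_exponent i.+1 A = Some (f i).

End Matrices.

(* Subsets of {1, ..., n} are finite sets of naturals, and words are sequences
   of naturals, both with the one-based labels of the mathematics. *)
Local Open Scope fset_scope.

Definition raise_at (a : nat) (I : {fset nat}) : {fset nat} :=
  if (a \in I) && (a.+1 \notin I) then a.+1 |` (I `\ a) else I.

Definition pass (Q : seq nat) (I : {fset nat}) : {fset nat} :=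
  foldl (fun J a => raise_at a J) I Q.

Definition lowest (k : nat) : {fset nat} := [fset i in iota 1 k].
Definition highest (n k : nat) : {fset nat} := [fset i in iota (n - k).+1 k].

Definition passage_time (n k : nat) (Q : seq nat) : option nat :=
  least (fun m => (0 < m)%N /\ iter m (pass Q) (lowest k) = highest n k).

(* The word (n-1) (n-2, n-1) ... (1, 2, ..., n-1). *)
Definition Omega (n : nat) : seq nat :=
  flatten [seq iota (n - j) j | j <- iota 1 n.-1].

Definition complete (n : nat) (Q : seq nat) : bool :=
  all (fun a => a \in Q) (iota 1 n.-1).

Definition complete_subword (n : nat) : {pred seq nat} :=
  [pred Q | subseq Q (Omega n) && complete n Q].

(* Main.v *)
Require Import Defs.
From mathcomp Require Import all_boot all_order all_algebra.
From mathcomp Require Import finmap boolp reals.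
From mathcomp Require Import zify ring.

(** Why the theorem holds.  A nonsingular totally nonnegative matrix is a
    product A = Y^T D X, where D is diagonal with positive entries and X, Y are
    products of elementary bidiagonal matrices 1 + t e_{a,a+1}, t >= 0, whose
    indices a run through the word Omega_n ([TN_factorization]).  Oscillatory
    matrices are nonsingular, so the factorization applies to them; the letters
    of X and Y with positive parameter form the words Q+ and Q-.

    Multiplying on the right by 1 + t e_{a,a+1} adds to the minor with column
    set J the minor where a+1 is replaced by a, multiplied by t, when a+1 is in
    J and a is not.  For t > 0 the positive minors with fixed rows I are
    thereby enlarged from a family S of column sets to the union of S and
    c_a^+(S).  If S is an interval [lo, hi] of the componentwise (Gale) order,
    that union is the interval [lo, c_a^+(hi)].  Dually, the transposed factor
    only lowers lo.  Hence for every product of such factors the positive minors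
    with rows I form an interval, and its upper end is obtained from I by the
    greedy moves c_a^+ alone ([interval_support]).  For A^m the upper end is the
    image of I under m passes of Q+; for its transpose, under m passes of Q-.
    Since the moves are monotone, all minors of order k of A^m are positive
    exactly when m passes of Q+ and m passes of Q- both carry L_k to R_k
    ([minors_gt0_reaches]).  This condition persists for larger m, so
    e_k(A) = max(t_k(Q+), t_k(Q-)) ([minor_exponent_udu]).  Conversely, every
    pair of words is realized by taking all parameters equal to 1.

    The factorization comes from Whitney's elimination of the last nonzero entry
    of the first row by the preceding column ([whitney_reduction]).  That total
    nonnegativity survives amounts to an inequality between ratios of minors,
    proved by induction on the number of columns on the left of the eliminated
    one: a Pluecker relation between cofactors compares a ratio with the ratio
    for minors of smaller order, and a Laplace expansion settles the start. *)

Set Implicit Arguments.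
Unset Strict Implicit.
Unset Printing Implicit Defensive.

Import Order.TTheory GRing.Theory Num.Theory.

(** * Determinants with a replaced column *)

Section ColumnReplacement.
Local Open Scope ring_scope.
Variable R : comPzRingType.

Definition set_col k (p : 'I_k) (v : 'I_k -> R) (B : 'M[R]_k) : 'M[R]_k :=
  \matrix_(i, j) (if j == p then v i else B i j).

Lemma cofactor_set_col k (p : 'I_k) v (B : 'M[R]_k) i :
  cofactor (set_col p v B) i p = cofactor B i p.
Proof.
rewrite /cofactor; congr (_ * \det (row' _ _)).
by apply/matrixP => x y; rewrite !mxE eq_sym (negbTE (neq_lift _ _)).
Qed.

Lemma det_set_col k (p : 'I_k) v (B : 'M[R]_k) :
  \det (set_col p v B) = \sum_i v i * cofactor B i p.
Proof.
rewrite (expand_det_col _ p); apply: eq_bigr => i _.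
by rewrite cofactor_set_col mxE eqxx.
Qed.

Lemma set_colC k (p r : 'I_k) u v (B : 'M[R]_k) : p != r ->
  set_col p u (set_col r v B) = set_col r v (set_col p u B).
Proof.
move=> npr; apply/matrixP=> i j; rewrite !mxE.
by case: eqP => // ->; rewrite (negbTE npr).
Qed.

Lemma cofactor_det_set_col k (p b : 'I_k) (B : 'M[R]_k) :
  cofactor B b p = \det (set_col p (fun i => (i == b)%:R) B).
Proof.
rewrite det_set_col (bigD1 b) //= eqxx mul1r big1 ?addr0 // => i /negbTE ->.
by rewrite mul0r.
Qed.

Lemma det_set_col_eq k (p q : 'I_k) (B : 'M[R]_k) v : p != q ->
  (forall i, v i = B i q) -> \det (set_col p v B) = 0.
Proof.
move=> npq vB; rewrite -det_tr (determinant_alternate npq) // => i.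
by rewrite !mxE eqxx eq_sym (negbTE npq) vB.
Qed.

Lemma det_set_col_swap k (p r : 'I_k) (B : 'M[R]_k) v w : p != r ->
  \det (set_col p v (set_col r w B)) = - \det (set_col p w (set_col r v B)).
Proof.
move=> npr; apply/eqP; rewrite -addr_eq0; apply/eqP.
have lin q x y (C : 'M[R]_k) :
  \det (set_col q (fun i => x i + y i) C)
  = \det (set_col q x C) + \det (set_col q y C).
  by rewrite !det_set_col -big_split; apply: eq_bigr => i _; rewrite mulrDl.
have alt x : \det (set_col p x (set_col r x B)) = 0.
  by apply: (det_set_col_eq npr) => i; rewrite mxE eqxx.
(* Polarization of the alternating property. *)
have := alt (fun i => v i + w i).
rewrite lin !(set_colC _ _ _ npr) !lin -!(set_colC _ _ _ npr) !alt.
by rewrite add0r addr0 addrC.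
Qed.

(** A three-term Pluecker relation.  Up to sign the cofactors are determinants
    where column r or p is a basis vector e.  Expanding det B * v on the columns
    of B by Cramer's rule kills all columns but p and r, the others being
    repeated. *)
Lemma cofactor_exchange k (p r b : 'I_k) (B : 'M[R]_k) v : p != r ->
  \det B * cofactor (set_col p v B) b r =
  \det (set_col p v B) * cofactor B b r - \det (set_col r v B) * cofactor B b p.
Proof.
move=> npr; have nrp : r != p by rewrite eq_sym.
pose e (i : 'I_k) : R := (i == b)%:R.
pose W := set_col r e B.
pose y q := \det (set_col q v B).
have detBv i : \det B * v i = \sum_q B i q * y q.
  have /matrixP/(_ i ord0) := congr1 (mulmx^~ (\col_i v i)) (mul_mx_adj B).
  rewrite -mulmxA mul_scalar_mx !mxE => <-; apply: eq_bigr => q _.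
  rewrite mxE /y det_set_col; congr (_ * _); apply: eq_bigr => l _.
  by rewrite !mxE mulrC.
rewrite cofactor_det_set_col -/e (set_colC _ _ _ nrp) -/W det_set_col mulr_sumr.
under eq_bigr => i _ do rewrite mulrA detBv mulr_suml.
rewrite exchange_big /=.
have col q : \sum_i B i q * y q * cofactor W i p
             = y q * \det (set_col p (fun i => B i q) W).
  by rewrite det_set_col mulr_sumr; apply: eq_bigr => i _; ring.
under eq_bigr => q _ do rewrite col.
rewrite (bigD1 p) //= (bigD1 r) //= big1 ?addr0; last first.
  move=> q /andP[nqp nqr]; rewrite (det_set_col_eq (q := q)) ?mulr0 //.
    by rewrite eq_sym.
  by move=> i; rewrite mxE (negbTE nqr).
rewrite cofactor_det_set_col -/e (cofactor_det_set_col p) -/e -/(y p) -/(y r).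
have -> : set_col p (fun i => B i p) W = set_col r e B.
  by apply/matrixP=> i j; rewrite !mxE; case: (eqVneq j p) => // ->;
     rewrite (negbTE npr).
rewrite det_set_col_swap // mulrN; congr (_ - _ * \det _).
apply/matrixP=> i j; rewrite !mxE; case: (eqVneq j p) => // _.
by case: eqP => [->|].
Qed.

End ColumnReplacement.

(** * Minors and elementary column operations *)

Section IncreasingMaps.

Definition incr k n (f : 'I_k -> 'I_n) := {homo f : i j / i < j}.

Lemma incr_inj k n (f : 'I_k -> 'I_n) : incr f -> injective f.
Proof.
move=> incf i j fij; apply/ord_inj; case: (ltngtP i j) => // /incf.
  by rewrite fij ltnn.
by rewrite fij ltnn.
Qed.

Lemma incr_lift k n (f : 'I_k.+1 -> 'I_n) (b : 'I_k.+1) :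
  incr f -> incr (f \o lift b).
Proof.
move=> incf i j ij /=; apply: incf => /=.
rewrite /bump; case: (leqP b i) => bi; case: (leqP b j) => bj; rewrite ?add1n ?add0n ?ltnS //.
  by have := leq_ltn_trans bi ij; rewrite ltnNge (ltnW bj).
exact: ltnW.
Qed.

Lemma incr_cons k n (f : 'I_k -> 'I_n) (z : 'I_n) :
  incr f -> (forall i, z < f i) ->
  incr (fun i : 'I_k.+1 => if unlift ord0 i is Some i' then f i' else z).
Proof.
move=> incf zf i j; case: unliftP => [i' ->|->]; case: unliftP => [j' ->|->] //=.
by rewrite /bump /= !add1n ltnS; exact: incf.
Qed.

Lemma incr_replace k n (g : 'I_k -> 'I_n) (c c' : 'I_n) (p : 'I_k) :
  (c.+1 = c' \/ c'.+1 = c) -> incr g -> g p = c' -> (forall i, g i != c) ->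
  incr [eta g with p |-> c].
Proof.
move=> cc' incg gp ngc i j ij /=; have := incg _ _ ij.
have nc q : (g q : nat) != c := ngc q.
have gp' : g p = c' :> nat by rewrite gp.
have := nc i; have := nc j.
case: (eqVneq i p) ij => [->|_]; case: (eqVneq j p) => [->|_]; lia.
Qed.

End IncreasingMaps.

Section Minors.
Local Open Scope ring_scope.
Variable R : comPzRingType.

Lemma cofactor_mxsub k m n (f : 'I_k.+1 -> 'I_m) (g : 'I_k.+1 -> 'I_n)
    (M : 'M[R]_(m, n)) b r :
  cofactor (mxsub f g M) b r
  = (-1) ^+ (b + r) * \det (mxsub (f \o lift b) (g \o lift r) M).
Proof. by rewrite /cofactor; congr (_ * \det _); apply/matrixP => i j; rewrite !mxE. Qed.

Lemma mxsub_replace k m n (f : 'I_k -> 'I_m) (g : 'I_k -> 'I_n)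
    (M : 'M[R]_(m, n)) p c :
  mxsub f [eta g with p |-> c] M = set_col p (fun i => M (f i) c) (mxsub f g M).
Proof. by apply/matrixP=> i j; rewrite !mxE /=; case: eqP. Qed.

Lemma minor_replace_eq0 k m n (f : 'I_k -> 'I_m) (g : 'I_k -> 'I_n)
    (M : 'M[R]_(m, n)) p q c : g p != c -> g q = c ->
  \det (mxsub f [eta g with p |-> c] M) = 0.
Proof.
move=> gp gq; rewrite mxsub_replace (@det_set_col_eq _ _ p q) //.
  by apply: contraNneq gp => ->; apply/eqP.
by move=> i; rewrite mxE gq.
Qed.

Definition shear n (c c' : 'I_n) (t : R) : 'M[R]_n := 1%:M + t *: delta_mx c c'.

Lemma mul_shearE m n (M : 'M[R]_(m, n)) c c' t i j :
  (M *m shear c c' t) i j = M i j + (if j == c' then t * M i c else 0).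
Proof.
rewrite mulmxDr mulmx1 -scalemxAr !mxE (bigD1 c) //= big1 ?addr0.
  by rewrite mxE eqxx /=; case: eqP => _; rewrite ?mulr1 ?mulr0.
by move=> q /negbTE nq; rewrite mxE nq mulr0.
Qed.

Lemma tr_shear n (c c' : 'I_n) t : (shear c c' t)^T = shear c' c t.
Proof. by rewrite /shear linearD linearZ /= trmx1 trmx_delta. Qed.

Lemma shearN n (c c' : 'I_n) t : c != c' -> shear c c' (- t) *m shear c c' t = 1%:M.
Proof.
move=> ncc; rewrite /shear mulmxDr mulmx1 -scalemxAr mulmxDl mul1mx -scalemxAl.
by rewrite mul_delta_mx_0 1?eq_sym // scaler0 addr0 scaleNr addrNK.
Qed.

Lemma mxsub_mul_shear k m n (f : 'I_k -> 'I_m) (g : 'I_k -> 'I_n)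
    (M : 'M[R]_(m, n)) c c' t :
  (forall q, g q != c') -> mxsub f g (M *m shear c c' t) = mxsub f g M.
Proof.
by move=> ng; apply/matrixP=> i j; rewrite [LHS]mxE mul_shearE (negbTE (ng j)) addr0 mxE.
Qed.

Lemma minor_mul_shear k m n (f : 'I_k -> 'I_m) (g : 'I_k -> 'I_n)
    (M : 'M[R]_(m, n)) c c' t p : injective g -> g p = c' ->
  \det (mxsub f g (M *m shear c c' t))
  = \det (mxsub f g M) + t * \det (mxsub f [eta g with p |-> c] M).
Proof.
move=> ginj gp.
have -> : mxsub f g (M *m shear c c' t)
    = set_col p (fun i => M (f i) c' + t * M (f i) c) (mxsub f g M).
  apply/matrixP=> i j; rewrite [LHS]mxE mul_shearE -gp (inj_eq ginj) !mxE.
  by case: eqP => [->|_] //; rewrite addr0.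
have -> : \det (mxsub f g M)
    = \det (set_col p (fun i => M (f i) c') (mxsub f g M)).
  congr (\det _); apply/matrixP=> i j; rewrite !mxE -gp.
  by case: eqP => [->|].
rewrite mxsub_replace !det_set_col mulr_sumr -big_split.
by apply: eq_bigr => i _ /=; ring.
Qed.

Lemma det_shear n (c c' : 'I_n) t : c != c' -> \det (shear c c' t) = 1.
Proof.
move=> ncc; rewrite -[shear _ _ _]mul1mx.
have sub_id (A : 'M[R]_n) : mxsub id id A = A by apply/matrixP=> i j; rewrite mxE.
rewrite -[_ *m _]sub_id (@minor_mul_shear _ _ _ _ _ _ _ _ _ c') //.
by rewrite (@minor_replace_eq0 _ _ _ _ _ _ _ c) 1?eq_sym // sub_id det1 mulr0 addr0.
Qed.

End Minors.

(** * Whitney's reduction *)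

Section Whitney.
Local Open Scope ring_scope.
Variables (R : realType) (n : nat) (M : 'M[R]_n) (z c c' : 'I_n).
Hypothesis TNM : totally_nonnegative M.
Hypotheses (z0 : z = 0%N :> nat) (cc' : c.+1 = c' :> nat).
Hypothesis Mz0 : forall j : 'I_n, (c' < j)%N -> M z j = 0.

Lemma minor_ge0 k (f g : 'I_k -> 'I_n) : incr f -> incr g ->
  0 <= \det (mxsub f g M).
Proof. exact: TNM. Qed.

(** When the eliminated column comes first in the minor, both sides are terms of
    the expansion along row z of the minor with row z and column c added; all
    other terms of that expansion vanish because row z is zero beyond c'. *)
Lemma leading_column_ratio k (f g : 'I_k.+1 -> 'I_n) :
  incr f -> incr g -> g ord0 = c' ->
  M z c' * \det (mxsub f [eta g with ord0 |-> c] M) <= M z c * \det (mxsub f g M).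
Proof.
move=> incf incg g0.
pose ext (h : 'I_k.+1 -> 'I_n) x (i : 'I_k.+2) :=
  if unlift ord0 i is Some i' then h i' else x.
have ext0 h x : ext h x ord0 = x by rewrite /ext unlift_none.
have extS h x i : ext h x (lift ord0 i) = h i by rewrite /ext liftK.
have incg' : incr (ext g c).
  apply: incr_cons => // i; apply: (@leq_trans (g ord0)); first by rewrite g0 cc'.
  by case: (posnP i) => [i0|i0]; [rewrite (_ : ord0 = i) //; apply/val_inj
    | apply/ltnW/incg].
have det_ge0 : 0 <= \det (mxsub (ext f z) (ext g c) M).
  (* Row z may already belong to the minor; it is then repeated. *)
  have [f0|f0] := posnP (f ord0).
    rewrite (@determinant_alternate _ _ _ ord0 (lift ord0 ord0)) // => j.
    by rewrite !mxE ext0 extS; congr (M _ _); apply/val_inj; rewrite /= f0 z0.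
  apply: minor_ge0 => //; apply: incr_cons => // i.
  rewrite z0; case: (posnP i) => [i0|i0]; first by rewrite (_ : i = ord0) //; apply/val_inj.
  by apply: (leq_ltn_trans (leq0n (f ord0))); apply: incf.
move: det_ge0; rewrite (expand_det_row _ ord0) (bigD1 ord0) //=.
rewrite (bigD1 (lift ord0 ord0)) //= big1 ?addr0; last first.
  move=> j /andP[j0 j1]; rewrite mxE ext0 Mz0 ?mul0r //.
  case: (unliftP ord0 j) j0 j1 => [j' ->|->] // _; rewrite extS => jj.
  rewrite -g0; apply: incg; rewrite lt0n; apply: contraNneq jj => j0.
  by apply/eqP; congr lift; apply/val_inj.
rewrite !mxE !ext0 !extS g0 !cofactor_mxsub.
rewrite -[X in _ -> is_true X]subr_ge0; set D := (X in 0 <= X -> _); set E := (X in _ -> 0 <= X).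
suff -> : D = E by [].
rewrite /D /E; congr (_ + _).
  rewrite addn0 expr0 mul1r; congr (_ * \det _); apply/matrixP=> i j.
  by rewrite !mxE /= !extS.
rewrite -mulrN; congr (_ * _).
rewrite /= /bump /= add0n expr1 mulN1r; congr (- \det _); apply/matrixP=> i j.
rewrite !mxE /= extS; congr (M _ _).
case: (eqVneq j ord0) => [->|j0].
  rewrite -[RHS](ext0 g); congr (ext _ _ _); exact/val_inj.
rewrite -(extS g c); congr (ext _ _ _); apply/val_inj => /=.
by rewrite /bump /=; case: j j0 => [[|j] ?].
Qed.

(** The inequality behind Whitney's reduction.  Write P and P' for the two
    minors, N_b and N'_b for the same minors without row b and without the
    column just before p.  The exchange relation gives P N'_b >= P' N_b and the
    induction hypothesis bounds N'_b by N_b, which gives the claim if some N'_b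
    is positive; if none is, P' vanishes by expansion along the removed
    column. *)
Lemma minor_ratio_le_row_ratio k (f g : 'I_k -> 'I_n) (p : 'I_k) :
  incr f -> incr g -> g p = c' -> (forall i, g i != c) ->
  M z c' * \det (mxsub f [eta g with p |-> c] M) <= M z c * \det (mxsub f g M).
Proof.
move pm : (val p) => m; elim: m k f g p pm => [|m IH] k f g p pm incf incg gp ngc.
  case: k f g p pm incf incg gp ngc => [|k] f g p pm incf incg gp ngc.
    by have := ltn_ord p.
  have p0 : p = ord0 by apply/val_inj.
  by rewrite p0 in gp *; exact: leading_column_ratio.
case: k f g p pm incf incg gp ngc => [|[|k]] f g p pm incf incg gp ngc.
- by have := ltn_ord p.
- by have := ltn_ord p; rewrite pm.
have mlt : (m < k.+1)%N by have := ltn_ord p; rewrite [p : nat]pm ltnS.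
pose p' : 'I_k.+1 := Ordinal mlt.
pose r : 'I_k.+2 := widen_ord (leqnSn _) p'.
have pr : lift r p' = p by apply/val_inj; rewrite /= /bump leqnn pm.
have npr : p != r by rewrite -pr eq_sym neq_lift.
set g' := [eta g with p |-> c].
have incg' : incr g' by exact: (incr_replace (or_introl cc') incg gp ngc).
have inc_r : incr [eta g with r |-> c].
  have nc q : (g q : nat) != c := ngc q.
  have gpc : g p = c.+1 :> nat by rewrite gp.
  have rv : r = m :> nat by [].
  move=> i j ij /=.
  case: (eqVneq i r) ij => [->|_]; case: (eqVneq j r) => [->|jr] ij.
  - by rewrite ltnn in ij.
  - have: (g p <= g j)%N.
      have [->//|jp] := eqVneq j p.
      apply/ltnW/incg; rewrite [p : nat]pm ltn_neqAle -[(m < j)%N]/(r < j)%N ij andbT.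
      by apply: contraNneq jp => jm; apply/eqP/ord_inj; rewrite -jm [p : nat]pm.
    by rewrite gpc.
  - have := incg i p; have := nc i; rewrite gpc [p : nat]pm -rv; lia.
  - exact: incg.
(* As r is adjacent to p, putting column c in place r keeps the columns
   increasing, and the cofactors at r and p have opposite signs. *)
have exch b : \det (mxsub f g M) * \det (mxsub (f \o lift b) (g' \o lift r) M)
    = \det (mxsub f g' M) * \det (mxsub (f \o lift b) (g \o lift r) M)
    + \det (mxsub f [eta g with r |-> c] M)
      * \det (mxsub (f \o lift b) (g \o lift p) M).
  have := cofactor_exchange b (mxsub f g M) (fun i => M (f i) c) npr.
  rewrite -!mxsub_replace -/g' !cofactor_mxsub.
  have -> : ((-1) ^+ (b + p) : R) = - (-1) ^+ (b + r).
    by rewrite pm addnS exprS mulN1r.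
  move=> H; apply: (mulfI (negbT (signr_eq0 R (b + r)))).
  by rewrite mulrCA H; ring.
have replE : g' \o lift r =1 [eta g \o lift r with p' |-> c].
  move=> i /=; rewrite -pr (inj_eq (@lift_inj _ r)); by [].
have eq_cols k' k'' (f1 : 'I_k' -> 'I_n) (g1 g2 : 'I_k'' -> 'I_n) : g1 =1 g2 ->
  mxsub f1 g1 M = mxsub f1 g2 M by move=> e; apply/matrixP=> i j; rewrite !mxE e.
have ind b : M z c' * \det (mxsub (f \o lift b) (g' \o lift r) M)
    <= M z c * \det (mxsub (f \o lift b) (g \o lift r) M).
  rewrite (eq_cols _ _ _ _ _ replE); apply: IH => //.
  - exact: incr_lift.
  - exact: incr_lift.
  - by rewrite /= pr.
  - by move=> i; apply: ngc.
have Mz_ge0 j : 0 <= M z j.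
  have := @minor_ge0 1 (fun=> z) (fun=> j).
  rewrite det_mx11 mxE; apply => [] [[|//] ?] [[|//] ?] //.
have [b Nb|N0] := pickP (fun b => 0 < \det (mxsub (f \o lift b) (g' \o lift r) M)).
  rewrite -(ler_pM2r Nb) -mulrA -[leRHS]mulrA exch.
  have P'0 : 0 <= \det (mxsub f g' M) by apply: minor_ge0.
  apply: (@le_trans _ _ (\det (mxsub f g' M) *
      (M z c * \det (mxsub (f \o lift b) (g \o lift r) M)))).
    by rewrite mulrCA; apply: ler_wpM2l.
  rewrite mulrCA; apply: ler_wpM2l => //; rewrite lerDl; apply: mulr_ge0.
    exact: minor_ge0.
  by apply: minor_ge0; exact: incr_lift.
suff -> : \det (mxsub f g' M) = 0 by rewrite mulr0 mulr_ge0 // minor_ge0.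
rewrite (expand_det_col _ r) big1 // => b _; rewrite cofactor_mxsub.
have := N0 b; rewrite lt0r minor_ge0 ?andbT; [|exact: incr_lift|exact: incr_lift].
by move/negbFE/eqP => ->; rewrite !mulr0.
Qed.

Lemma whitney_reduction : 0 < M z c ->
  totally_nonnegative (M *m shear c c' (- (M z c' / M z c))).
Proof.
move=> Mzc k f g incf incg.
have [p /eqP gp|ng] := pickP (fun p => g p == c'); last first.
  by rewrite mxsub_mul_shear ?minor_ge0 // => q; rewrite ng.
rewrite (@minor_mul_shear _ _ _ _ _ _ _ _ _ _ p) //; last exact: incr_inj.
have [q /eqP gq|ngc] := pickP (fun q => g q == c).
  rewrite (@minor_replace_eq0 _ _ _ _ _ _ _ _ q) ?mulr0 ?addr0 ?minor_ge0 //.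
  by rewrite gp -val_eqE /= -cc' neq_ltn ltnSn orbT.
rewrite mulNr subr_ge0 mulrAC ler_pdivrMr // [leRHS]mulrC.
by apply: minor_ratio_le_row_ratio => // q; rewrite ngc.
Qed.

End Whitney.

(** * Factorization of nonsingular totally nonnegative matrices *)

Section Omega.

(** Omega is built from the outside in: its last block eliminates the first row,
    and the rest is the word of the trailing matrix with labels shifted. *)
Lemma OmegaS n : Omega n.+1 = map S (Omega n) ++ iota 1 n.
Proof.
case: n => // n; have iotaE : iota 1 n.+1 = iota 1 n ++ [:: n.+1].
  by rewrite -(iotaD 1 n 1) addn1.
rewrite /Omega [n.+2.-1]/= [in LHS]iotaE map_cat flatten_cat [n.+1.-1]/=.
congr (_ ++ _); last by rewrite /= cats0 subSS subSnn.
rewrite map_flatten -map_comp; congr flatten; apply/eq_in_map => j /=.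
rewrite mem_iota add1n ltnS => /andP[_ jn]; rewrite subSn ?(leqW jn) //.
by rewrite (iotaDl 1).
Qed.

Lemma Omega_letter n a : a \in Omega n -> 0 < a < n.
Proof.
elim: n a => // n IH a; rewrite OmegaS mem_cat mem_iota add1n => /orP[|//].
by case/mapP=> b /IH + ->; case/andP.
Qed.

End Omega.

Section Factorization.
Local Open Scope ring_scope.
Variable R : realType.

(** The elementary bidiagonal factor of a letter x.1 with parameter x.2; letters
    are one-based, so that letter a
    concerns the zero-based indices a - 1 and a. *)
Definition letter_mx n (x : nat * R) : 'M[R]_n :=
  \matrix_(i, j) ((i == j)%:R + x.2 *+ ((i.+1 == x.1) && (j == x.1 :> nat))).

Definition word_mx n (w : seq (nat * R)) : 'M[R]_n :=
  foldr (fun x B => letter_mx n x *m B) 1%:M w.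

Definition nonneg (w : seq (nat * R)) := all (fun x => 0 <= x.2) w.

Lemma letter_mx_shear n (c c' : 'I_n) t : c.+1 = c' :> nat ->
  letter_mx n (c' : nat, t) = shear c c' t.
Proof.
move=> cc'; apply/matrixP=> i j; rewrite !mxE /=.
have -> : (i.+1 == c' :> nat) = (i == c) by rewrite -cc' eqSS.
rewrite -[(j == c')%N]/(j == c').
by case: (_ && _); rewrite ?mulr1 ?mulr0.
Qed.

Lemma word_mx_cat n w1 w2 : word_mx n (w1 ++ w2) = word_mx n w1 *m word_mx n w2.
Proof. by elim: w1 => [|x w IH] /=; rewrite ?mul1mx // IH mulmxA. Qed.

Lemma word_mx_rcons n w x : word_mx n (rcons w x) = word_mx n w *m letter_mx n x.
Proof. by rewrite -cats1 word_mx_cat /= mulmx1. Qed.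

(** Relabelling for a matrix of the next size, seen as its trailing block. *)
Definition shift (x : nat * R) := (x.1.+1, x.2).

Lemma letter_mx_shift n x : (0 < x.1)%N ->
  letter_mx (1 + n) (shift x) = block_mx 1%:M 0 0 (letter_mx n x).
Proof.
case: x => [[//|a] t] _; apply/matrixP=> i j.
case: (split_ordP i) => i' ->; case: (split_ordP j) => j' ->.
- by rewrite block_mxEul !mxE /= !ord1 /= addr0.
- by rewrite block_mxEur !mxE /= !ord1 /= addr0.
- by rewrite block_mxEdl !mxE /= !ord1 /= andbF addr0.
- by rewrite block_mxEdr !mxE /= eq_rshift.
Qed.

Lemma word_mx_shift n w : all (fun x => 0 < x.1)%N w ->
  word_mx (1 + n) (map shift w) = block_mx 1%:M 0 0 (word_mx n w).
Proof.
elim: w => [_|x w IH] /=; first by rewrite -scalar_mx_block.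
case/andP=> x0 /IH /= ->; rewrite letter_mx_shift // (mulmx_block (1%:M : 'M[R]_1)).
by rewrite !mulmx0 !mul0mx !mulmx1 !addr0 !add0r.
Qed.

Lemma TN_tr n (A : 'M[R]_n) : totally_nonnegative A -> totally_nonnegative A^T.
Proof.
move=> TN k f g incf incg; rewrite -[X in \det X]trmxK det_tr.
have -> : (mxsub f g A^T)^T = mxsub g f A by apply/matrixP=> i j; rewrite !mxE.
exact: TN.
Qed.

Lemma TN_entry_ge0 n (A : 'M[R]_n) i j : totally_nonnegative A -> 0 <= A i j.
Proof.
move=> TN; have := TN 1%N (fun=> i) (fun=> j); rewrite det_mx11 mxE.
by apply => [] [[|//] ?] [[|//] ?].
Qed.

(** A zero followed by a nonzero entry in the first row would, with a nonzero
    entry of the same column as the zero, give a negative minor of order 2. *)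
Lemma TN_first_row_support n (A : 'M[R]_n) (z c c' : 'I_n) :
  totally_nonnegative A -> \det A != 0 -> z = 0%N :> nat ->
  c.+1 = c' :> nat -> A z c' != 0 -> 0 < A z c.
Proof.
move=> TN detA z0 cc' Ac'; rewrite lt0r TN_entry_ge0 // andbT.
apply: contraNneq detA => Ac; rewrite (expand_det_col _ c) big1 // => i _.
suff -> : A i c = 0 by rewrite mul0r.
have [i0|i0] := posnP i.
  by rewrite -Ac; congr (A _ _); apply/val_inj; rewrite /= i0 z0.
pose f (x : 'I_2) := if x == ord0 then z else i.
pose g (x : 'I_2) := if x == ord0 then c else c'.
have incf : incr f.
  by case=> [[|[|//]] ?] [[|[|//]] ?] //= _; rewrite /f /= z0.
have incg : incr g.
  by case=> [[|[|//]] ?] [[|[|//]] ?] //= _; rewrite /g /= -cc'.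
have := TN _ f g incf incg; rewrite (expand_det_row _ ord0) !big_ord_recl big_ord0.
rewrite !cofactor_mxsub !det_mx11 !mxE /f /g /= Ac mul0r add0r addr0.
rewrite expr1 mulN1r mulrN.
rewrite oppr_ge0 => le0; apply/eqP; move: (TN_entry_ge0 i c TN); rewrite le0r.
case/orP=> // Aic; suff : 0 < A z c' * A i c by rewrite ltNge le0.
by rewrite mulr_gt0 // lt0r Ac' TN_entry_ge0.
Qed.

(** The entries of the first row are eliminated from right to left, so the
    factors accumulate in increasing order of letters.  Column 0 is never
    modified: a matrix whose first column is already cleared keeps it so. *)
Lemma sweep_row n (M : 'M[R]_n.+1) m : (m <= n)%N ->
  totally_nonnegative M -> \det M != 0 ->
  (forall j : 'I_n.+1, (m < j)%N -> M ord0 j = 0) ->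
  exists B w,
    [/\ totally_nonnegative B, \det B != 0,
        forall j : 'I_n.+1, (0 < j)%N -> B ord0 j = 0
      & forall i, B i ord0 = M i ord0]
    /\ [/\ map fst w = iota 1 m, nonneg w
      & M = B *m word_mx n.+1 w].
Proof.
elim: m M => [|m IH] M mn TN detM Mz.
  by exists M, [::]; do 2!split=> //; rewrite mulmx1.
pose c : 'I_n.+1 := Ordinal (leq_trans mn (leqnSn n)).
pose c' : 'I_n.+1 := Ordinal (mn : m.+1 < n.+1)%N.
have ncc' : c != c' by rewrite -val_eqE /= neq_ltn leqnn.
have shearM t : shear c c' t = letter_mx n.+1 (m.+1, t) by rewrite -letter_mx_shear.
pose t := M ord0 c' / M ord0 c.
(* If the entry to eliminate is zero, so is t, by 0 / x = 0. *)
pose M1 := M *m shear c c' (- t).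
have t_ge0 : 0 <= t by apply: divr_ge0; apply: TN_entry_ge0.
have [TN1 Mt] : totally_nonnegative M1 /\ M ord0 c' = t * M ord0 c.
  have [Mc'|Mc'] := eqVneq (M ord0 c') 0.
    rewrite Mc' /M1 /t Mc' mul0r; split; last by rewrite mul0r.
    by rewrite oppr0 /shear scale0r addr0 mulmx1.
  have Mc : 0 < M ord0 c by apply: (TN_first_row_support (c' := c')).
  split; first by apply: whitney_reduction => // j; apply: Mz.
  by rewrite /t divfK // lt0r_neq0.
have [||j mj|B [w [[TB dB B0 Bc] [wi w0 E]]]] := IH M1 _ TN1.
- exact: ltnW.
- by rewrite det_mulmx det_shear // mulr1.
- rewrite mul_shearE; case: eqVneq => [->|jc]; first by rewrite Mt mulNr subrr.
  rewrite addr0 Mz // ltn_neqAle mj andbT.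
  by apply: contraNneq jc => jc; apply/eqP/val_inj; rewrite /= jc.
exists B, (rcons w (m.+1, t)); split; split=> //.
- by move=> i; rewrite Bc mul_shearE -val_eqE /= addr0.
- by rewrite map_rcons wi -cats1 -(iotaD 1 m 1) addn1.
- by rewrite /nonneg all_rcons t_ge0.
- by rewrite word_mx_rcons mulmxA -E -shearM -mulmxA shearN // mulmx1.
Qed.

(** Sweeping the first column (through the transpose) and the first row leaves a
    block diagonal matrix, whose trailing block is factored by induction. *)
Lemma TN_factorization n (A : 'M[R]_n) :
  totally_nonnegative A -> \det A != 0 ->
  exists wx wy (d : 'rV[R]_n),
    [/\ map fst wx = Omega n, map fst wy = Omega n,
        nonneg wx & nonneg wy]
    /\ (forall i, 0 < d ord0 i)
    /\ A = (word_mx n wy)^T *m diag_mx d *m word_mx n wx.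
Proof.
elim: n A => [|n IH] A TN detA.
  exists [::], [::], 0; do 2!split => //; first by case.
  by apply/matrixP=> [[]].
have no_col (M : 'M[R]_n.+1) (j : 'I_n.+1) : (n < j)%N -> M ord0 j = 0.
  by rewrite ltnNge -ltnS ltn_ord.
have detT : \det A^T != 0 by rewrite det_tr.
have [B1 [wy [[TN1 dB1 B1r _] [wyi wy0 EY]]]] :=
  sweep_row (leqnn n) (TN_tr TN) detT (no_col _).
have dB1T : \det B1^T != 0 by rewrite det_tr.
have [B [wx [[TNB dB Br Bc] [wxi wx0 EX]]]] :=
  sweep_row (leqnn n) (TN_tr TN1) dB1T (no_col _).
pose a := B ord0 ord0; pose C : 'M[R]_n := @drsubmx _ 1 n 1 n B.
have EB : B = block_mx (a%:M : 'M_1) 0 0 C.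
  have ul : @ulsubmx _ 1 n 1 n B = a%:M.
    apply/matrixP=> i j; rewrite !mxE !ord1 eqxx.
    by congr (B _ _); apply/val_inj.
  have ur : @ursubmx _ 1 n 1 n B = 0.
    apply/matrixP=> i j; rewrite !mxE !ord1 [lshift _ _](_ : _ = ord0) ?Br //.
    exact/val_inj.
  have dl : @dlsubmx _ 1 n 1 n B = 0.
    apply/matrixP=> i j; rewrite !mxE !ord1 [lshift _ _](_ : _ = ord0).
      by rewrite Bc mxE B1r.
    exact/val_inj.
  by rewrite -[LHS](@submxK _ 1 n 1 n) ul ur dl.
have detB : \det B = a * \det C.
  rewrite [in LHS]EB; apply: etrans (det_ublock (a%:M : 'M_1) 0 C) _.
  by rewrite det_scalar1.
have a0 : 0 < a.
  rewrite lt0r TN_entry_ge0 // andbT.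
  by apply: contraNneq dB => a0; rewrite detB a0 mul0r.
have TNC : totally_nonnegative C.
  move=> k f g incf incg.
  have -> : mxsub f g C
      = mxsub (fun i => lift ord0 (f i)) (fun i => lift ord0 (g i)) B.
    by apply/matrixP=> i j; rewrite !mxE; congr (B _ _); apply/val_inj.
  by apply: TNB => i j ij /=; rewrite /bump /= !add1n ltnS; [apply: incf|apply: incg].
have detC : \det C != 0.
  by apply: contraNneq dB => dC; rewrite detB dC mulr0.
have [wx' [wy' [d [[wxi' wyi' wx0' wy0'] [d0 EC]]]]] := IH C TNC detC.
have letters w : map fst w = Omega n -> all (fun x : nat * R => 0 < x.1)%N w.
  move=> ww; apply/allP=> x /(map_f fst); rewrite ww => /Omega_letter.
  by case/andP.
have words w w' : map fst w = Omega n -> map fst w' = iota 1 n ->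
    map fst (map shift w ++ w') = Omega n.+1.
  move=> ww ww'; rewrite map_cat ww' OmegaS -ww -!map_comp; congr (_ ++ _).
have signs w w' : nonneg w -> nonneg w' ->
    nonneg (map shift w ++ w').
  by rewrite /nonneg all_cat all_map => s ->; rewrite andbT; apply: sub_all s.
exists (map shift wx' ++ wx), (map shift wy' ++ wy), (row_mx a%:M d).
split; first by split; [exact: words|exact: words|exact: signs|exact: signs].
split.
  move=> i; case: (@split_ordP 1 n i) => j ->.
    by rewrite (row_mxEl (a%:M : 'M_1)) mxE (ord1 j).
  by rewrite (row_mxEr (a%:M : 'M_1)).
have EB' : B = (block_mx (1%:M : 'M_1) 0 0 (word_mx n wy'))^T
    *m diag_mx (row_mx a%:M d) *m block_mx (1%:M : 'M_1) 0 0 (word_mx n wx').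
  rewrite EB EC tr_block_mx diag_mx_row !mulmx_block !trmx0 trmx1.
  rewrite !mulmx0 !mul0mx !mulmx1 !mul1mx !addr0 !add0r mul0mx.
  suff -> : diag_mx (a%:M : 'M_1) = a%:M by [].
  by apply/matrixP=> i j; rewrite !mxE (ord1 i) (ord1 j).
rewrite !word_mx_cat trmx_mul (word_mx_shift _ (letters _ wxi')).
rewrite (word_mx_shift _ (letters _ wyi')) -!mulmxA.
rewrite [X in _ = _ *m X]mulmxA [X in _ = _ *m X]mulmxA.
rewrite -EB' -EX.
by rewrite -[A]trmxK EY trmx_mul.
Qed.

End Factorization.

(** * Greedy moves and intervals of the Gale order *)

Section GaleOrder.
Variable k : nat.
Implicit Types (h lo hi g : 'I_k -> nat) (a : nat).

(** The move c_a^+ on a set of one-based labels listed increasingly by h. *)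
Definition raise a h (i : 'I_k) : nat :=
  if (h i == a) && [forall j, h j != a.+1] then a.+1 else h i.

Definition raises h (Q : seq nat) := foldl (fun h' a => raise a h') h Q.

(** The opposite move, from a+1 to a, on zero-based indices. *)
Definition lower a lo (i : 'I_k) : nat :=
  if (lo i == a.+1) && [forall j, lo j != a] then a else lo i.

Lemma raises_cat h Q Q' : raises h (Q ++ Q') = raises (raises h Q) Q'.
Proof. exact: foldl_cat. Qed.

Lemma incr_nat_lt h i j : {homo h : x y / x < y} -> h i < h j -> i < j.
Proof.
move=> inch hij; rewrite ltnNge leq_eqVlt; apply/negP => /orP[/eqP ji|/inch].
  by have /ord_inj ji' := ji; rewrite ji' ltnn in hij.
by rewrite ltnNge (ltnW hij).
Qed.

Lemma incr_nat_inj h : {homo h : x y / x < y} -> injective h.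
Proof.
move=> inch i j hij; apply/ord_inj; case: (ltngtP i j) => // /inch.
  by rewrite hij ltnn.
by rewrite hij ltnn.
Qed.

Lemma raise_ge a h i : h i <= raise a h i.
Proof. by rewrite /raise; case: ifP => // /andP[/eqP ->]. Qed.

Lemma raises_ge h Q i : h i <= raises h Q i.
Proof.
elim: Q h => //= a Q IH h; exact: leq_trans (raise_ge a h i) (IH _).
Qed.

Lemma raise_incr a h : {homo h : i j / i < j} -> {homo raise a h : i j / i < j}.
Proof.
move=> inch i j ij; have hij := inch _ _ ij; rewrite /raise.
case: andP => [[/eqP hi /forallP na]|_]; last first.
  by apply: leq_trans hij _; case: ifP => // /andP[/eqP ->].
by have := na j; case: ifP => [/andP[/eqP hj _]|_]; lia.
Qed.

Lemma raises_incr h Q : {homo h : i j / i < j} -> {homo raises h Q : i j / i < j}.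
Proof. by elim: Q h => //= a Q IH h inch; apply/IH/raise_incr. Qed.

(** If h moves its entry a and h' has the same entry, then h' may move too: an
    entry a+1 of h' would force the next entry of h to be a+1. *)
Lemma raise_mono a h h' : {homo h : i j / i < j} -> {homo h' : i j / i < j} ->
  (forall i, h i <= h' i) -> forall i, raise a h i <= raise a h' i.
Proof.
move=> inch inch' hh' i; rewrite [raise a h i]/raise.
case: andP => [[/eqP hi /forallP na]|_]; last exact: leq_trans (hh' i) (raise_ge _ _ _).
have := hh' i; rewrite hi leq_eqVlt => /orP[/eqP ai|]; last first.
  by move=> lt; apply: leq_trans lt (raise_ge _ _ _).
rewrite /raise -ai eqxx /= ifT //; apply/forallP=> j; apply/eqP => h'j.
have ij : i < j by apply: (incr_nat_lt inch'); rewrite h'j -ai.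
by have := inch _ _ ij; have := hh' j; have := na j; rewrite hi h'j; lia.
Qed.

Lemma raises_mono Q h h' : {homo h : i j / i < j} -> {homo h' : i j / i < j} ->
  (forall i, h i <= h' i) -> forall i, raises h Q i <= raises h' Q i.
Proof.
elim: Q h h' => //= a Q IH h h' inch inch' hh'.
by apply: IH; [exact: raise_incr|exact: raise_incr|exact: raise_mono].
Qed.

Lemma lower_le a lo i : lower a lo i <= lo i.
Proof. by rewrite /lower; case: ifP => // /andP[/eqP ->]. Qed.

Lemma lower_incr a lo : {homo lo : i j / i < j} -> {homo lower a lo : i j / i < j}.
Proof.
move=> incl i j ij; have lij := incl _ _ ij; rewrite /lower.
case: (ifP (_ && _)) => [/andP[/eqP li _]|_].
  by case: ifP => [/andP[/eqP lj _]|_]; lia.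
by case: ifP => // /andP[/eqP lj /forallP/(_ i)]; lia.
Qed.

(** Enlarging [lo, hi] by the raised columns gives [lo, c_a^+(hi)]: a sequence g
    below the new bound but not below hi exceeds hi only at the moved entry, and lowering it there gives an element of [lo, hi], because
    lo <= f < hi leaves room below.  Entries of g, lo and f are zero-based column
    indices, those of hi are one-based labels; membership is lo <= g < hi. *)
Lemma raise_interval_at a lo hi f g g' p :
  {homo hi : i j / i < j} -> {homo g : i j / i < j} ->
  (forall i, lo i <= f i < hi i) ->
  g p = a.+1 -> g' p = a -> (forall i, i != p -> g' i = g i) ->
  (forall i, lo i <= g i < raise a.+1 hi i) <->
  (forall i, lo i <= g i < hi i) \/ (forall i, lo i <= g' i < hi i).
Proof.
move=> inch incg lofhi gp g'p g'E; split=> [H|[H i|H i]]; last 2 first.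
- case/andP: (H i) => -> /leq_trans /= -> //; exact: raise_ge.
- have [->|ip] := eqVneq i p; last first.
    rewrite -g'E //; case/andP: (H i) => -> /leq_trans /= -> //; exact: raise_ge.
  case/andP: (H p) => lop hip; rewrite gp; apply/andP; split; first by lia.
  rewrite g'p leq_eqVlt in hip; case/orP: hip => [/eqP hip|hip]; last first.
    exact: leq_trans hip (raise_ge _ _ _).
  rewrite /raise -hip eqxx ifT //=; apply/forallP=> q; apply/eqP => hq.
  have pq : p < q by apply: (incr_nat_lt inch); rewrite hq -hip.
  have qp : q != p by rewrite -val_eqE /= neq_ltn pq orbT.
  by have := incg _ _ pq; have := H q; rewrite hq gp (g'E _ qp); lia.
have [/forallP all_lt|/forallPn[i /negbTE hgi]] := boolP [forall i, g i < hi i].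
  by left=> i; rewrite all_lt andbT; case/andP: (H i).
right; have: g i < raise a.+1 hi i by case/andP: (H i).
rewrite /raise; case: ifP => [/andP[/eqP hi_i /forallP na]|_]; last by rewrite hgi.
move=> gi; have ip : i = p by apply: (incr_nat_inj incg); rewrite gp; lia.
subst i => j; have [->|jp] := eqVneq j p.
  by rewrite g'p; have := lofhi p; lia.
have := H j; rewrite g'E // /raise ifF //.
by apply/negbTE; rewrite negb_and -hi_i (inj_eq (incr_nat_inj inch)) jp.
Qed.

(** Columns that are not the result of a move gain nothing from raising hi. *)
Lemma raise_interval_away a lo hi g :
  {homo hi : i j / i < j} -> {homo g : i j / i < j} ->
  (forall i, g i != a.+1) \/ (exists q, g q = a) ->
  (forall i, lo i <= g i < raise a.+1 hi i) <-> (forall i, lo i <= g i < hi i).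
Proof.
move=> inch incg nog; split=> H i; last first.
  by case/andP: (H i) => -> /leq_trans /= -> //; exact: raise_ge.
have := H i; rewrite {1}/raise; case: ifP => // /andP[/eqP hi_i _].
case/andP=> -> /= gi; rewrite hi_i ltn_neqAle -ltnS gi andbT; apply/eqP => gia.
case: nog => [/(_ i)|[q gq]]; first by rewrite gia eqxx.
have qi : q < i by apply: (incr_nat_lt incg); rewrite gq gia.
have := inch _ _ qi; have := H q; rewrite gq hi_i /raise.
by case: ifP => [/andP[/eqP ->]|]; lia.
Qed.

Lemma lower_interval_at a lo hi f g g' p :
  {homo lo : i j / i < j} -> {homo g : i j / i < j} ->
  (forall i, lo i <= f i < hi i) ->
  g p = a -> g' p = a.+1 -> (forall i, i != p -> g' i = g i) ->
  (forall i, lower a lo i <= g i < hi i) <->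
  (forall i, lo i <= g i < hi i) \/ (forall i, lo i <= g' i < hi i).
Proof.
move=> incl incg lofhi gp g'p g'E; split=> [H|[H i|H i]]; last 2 first.
- by case/andP: (H i) => lg ->; rewrite (leq_trans (lower_le _ _ _) lg).
- have [->|ip] := eqVneq i p; last first.
    by rewrite -g'E //; case/andP: (H i) => lg ->; rewrite (leq_trans (lower_le _ _ _) lg).
  case/andP: (H p); rewrite g'p gp leq_eqVlt => lop hip.
  apply/andP; split; last by lia.
  case/orP: lop => [/eqP lop|lop]; last first.
    by rewrite ltnS in lop; exact: leq_trans (lower_le _ _ _) lop.
  rewrite /lower lop eqxx ifT //=; apply/forallP=> q; apply/eqP => lq.
  have qp : q < p by apply: (incr_nat_lt incl); rewrite lq lop.
  have npq : q != p by rewrite -val_eqE /= neq_ltn qp.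
  by have := incg _ _ qp; have := H q; rewrite lq gp (g'E _ npq); lia.
have [/forallP all_le|/forallPn[i]] := boolP [forall i, lo i <= g i].
  by left=> i; rewrite all_le; case/andP: (H i).
rewrite -ltnNge => gli; right; have: lower a lo i <= g i by case/andP: (H i).
rewrite /lower; case: ifP => [/andP[/eqP lo_i /forallP na]|_]; last by lia.
move=> gi; have ip : i = p by apply: (incr_nat_inj incg); rewrite gp; lia.
subst i => j; have [->|jp] := eqVneq j p.
  by rewrite g'p; have := lofhi p; lia.
have := H j; rewrite g'E // /lower ifF //.
by apply/negbTE; rewrite negb_and -lo_i (inj_eq (incr_nat_inj incl)) jp.
Qed.

Lemma lower_interval_away a lo hi g :
  {homo lo : i j / i < j} -> {homo g : i j / i < j} ->
  (forall i, g i != a) \/ (exists q, g q = a.+1) ->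
  (forall i, lower a lo i <= g i < hi i) <-> (forall i, lo i <= g i < hi i).
Proof.
move=> incl incg nog; split=> H i; last first.
  by case/andP: (H i) => lg ->; rewrite (leq_trans (lower_le _ _ _) lg).
have := H i; rewrite {1}/lower; case: ifP => // /andP[/eqP lo_i _].
case/andP=> gi ->; rewrite andbT lo_i ltn_neqAle gi andbT eq_sym; apply/eqP => gia.
case: nog => [/(_ i)|[q gq]]; first by rewrite gia eqxx.
have iq : i < q by apply: (incr_nat_lt incg); rewrite gq gia.
have := incl _ _ iq; have := H q; rewrite gq lo_i /lower.
by case: ifP => [/andP[/eqP ->]|]; lia.
Qed.

End GaleOrder.

(** * Supports of minors are intervals *)

Section IntervalSupport.
Local Open Scope ring_scope.
Variables (R : realType) (n k : nat).
Implicit Types (M : 'M[R]_n) (Q : seq nat).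

(** The positive minors with given rows form an interval of the Gale order.  Only
    the upper end is named, being a function of the word Q; lower ends are
    controlled through the upper ends of the transpose. *)
Definition interval_support M Q := forall f : 'I_k -> 'I_n, incr f ->
  exists lo : 'I_k -> nat,
    [/\ {homo lo : i j / (i < j)%N}, forall i, (lo i <= f i)%N
      & forall g : 'I_k -> 'I_n, incr g ->
          0 <= \det (mxsub f g M) /\
          (0 < \det (mxsub f g M) <->
           forall i, (lo i <= g i < raises (fun i => (f i).+1) Q i)%N)].

(** At the first index where f and g differ, the smaller of the two values is
    missed by the other map, so the minor has a zero row or column. *)
Lemma interval_support1 : interval_support 1%:M [::].
Proof.
move=> f incf; exists f; split=> // g incg /=.
have incf' : {homo (fun i => f i : nat) : i j / (i < j)%N} := incf.
have incg' : {homo (fun i => g i : nat) : i j / (i < j)%N} := incg.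
have -> : \det (mxsub f g (1%:M : 'M[R]_n)) = [forall i, f i == g i]%:R.
  have [/forallP fg|/forallPn[i0 ni0]] := boolP [forall i, f i == g i].
    rewrite -[RHS](det1 R k); congr (\det _); apply/matrixP=> i j.
    by rewrite !mxE -(eqP (fg j)) (inj_eq (incr_inj incf)).
  have [i nfgi min_i] := @arg_minnP _ i0 (fun i => f i != g i) val ni0.
  have agree (j : 'I_k) : (j < i)%N -> f j = g j.
    by move=> ji; apply: contraTeq ji => /min_i; rewrite -leqNgt.
  have [lt|gt|eq_fg] := ltngtP (f i) (g i); last by rewrite (ord_inj eq_fg) eqxx in nfgi.
    rewrite (expand_det_row _ i) big1 // => j _; rewrite !mxE.
    case: eqP => [fij|_]; last by rewrite mul0r.
    have ji : (j < i)%N by apply: (incr_nat_lt incg'); rewrite -fij.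
    by have := incf _ _ ji; rewrite (agree j ji) -fij ltnn.
  rewrite (expand_det_col _ i) big1 // => j _; rewrite !mxE.
  case: eqP => [fji|_]; last by rewrite mul0r.
  have ji : (j < i)%N by apply: (incr_nat_lt incf'); rewrite fji.
  by have := incg _ _ ji; rewrite -(agree j ji) fji ltnn.
split; first exact: ler0n.
rewrite ltr0n lt0b; split=> [/forallP fg i|H].
  by rewrite (eqP (fg i)) leqnn ltnSn.
by apply/forallP=> i; apply/eqP/ord_inj; have := H i; lia.
Qed.

Lemma interval_support_up M Q (c c' : 'I_n) t : c.+1 = c' :> nat -> 0 < t ->
  interval_support M Q -> interval_support (M *m shear c c' t) (rcons Q c').
Proof.
move=> cc' t0 suppM f incf; have [lo [incl lof suppf]] := suppM f incf.
exists lo; split=> // g incg; have [P0 Ppos] := suppf g incg.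
pose hi := raises (fun i => (f i).+1) Q.
have inchi : {homo hi : i j / (i < j)%N}.
  by apply: raises_incr => i j ij; rewrite ltnS; apply: incf.
have lofhi i : (lo i <= f i < hi i)%N by rewrite lof; apply: raises_ge.
rewrite -cats1 raises_cat /= -/hi -cc'.
have incg' : {homo (fun i => g i : nat) : i j / (i < j)%N} := incg.
have [p /eqP gp|nog] := pickP (fun p => g p == c'); last first.
  rewrite mxsub_mul_shear; last by move=> q; rewrite nog.
  split=> //; rewrite raise_interval_away //; left=> i.
  by rewrite cc'; have := nog i; rewrite -val_eqE /= => ->.
rewrite (minor_mul_shear _ _ _ _ (incr_inj incg) gp).
have [q /eqP gq|noc] := pickP (fun q => g q == c).
  rewrite (minor_replace_eq0 _ _ _ gq) ?mulr0 ?addr0; last first.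
    by rewrite gp -val_eqE /= -cc' neq_ltn ltnSn orbT.
  by split=> //; rewrite raise_interval_away //; right; exists q; rewrite gq.
have incr' : incr [eta g with p |-> c].
  by apply: (incr_replace (or_introl cc') incg gp) => i; rewrite noc.
have [P0' Ppos'] := suppf _ incr'.
split; first by rewrite addr_ge0 // mulr_ge0 // ltW.
rewrite (raise_interval_at (g' := fun i => [eta g with p |-> c] i) inchi incg' lofhi (p := p)).
- rewrite -Ppos -Ppos'; split=> [|[]].
  + rewrite lt0r => /andP[]; case: (eqVneq (\det (mxsub f g M)) 0) => [->|? _ _].
      rewrite add0r mulf_eq0 negb_or => /andP[_ P'n] _; right.
      by rewrite lt0r P'n.
    by left; rewrite lt0r P0 andbT.
  + by move=> P; rewrite ltr_wpDr // mulr_ge0 // ltW.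
  + by move=> P; rewrite ltr_wpDl // mulr_gt0.
- by rewrite gp.
- by rewrite /= eqxx.
- by move=> i /= /negbTE ->.
Qed.

Lemma interval_support_down M Q (c c' : 'I_n) t : c.+1 = c' :> nat -> 0 <= t ->
  interval_support M Q -> interval_support (M *m shear c' c t) Q.
Proof.
move=> cc'; rewrite le0r => /orP[/eqP ->|t0] suppM.
  by rewrite /shear scale0r addr0 mulmx1.
move=> f incf; have [lo [incl lof suppf]] := suppM f incf.
exists (lower c lo); split=> [|i|g incg]; first exact: lower_incr.
  exact: leq_trans (lower_le _ _ _) (lof i).
have [P0 Ppos] := suppf g incg.
set hi := raises _ Q in suppf Ppos *.
have lofhi i : (lo i <= f i < hi i)%N by rewrite lof; apply: raises_ge.
have incg' : {homo (fun i => g i : nat) : i j / (i < j)%N} := incg.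
have [p /eqP gp|nog] := pickP (fun p => g p == c); last first.
  rewrite mxsub_mul_shear; last by move=> q; rewrite nog.
  split=> //; rewrite lower_interval_away //; left=> i.
  by have := nog i; rewrite -val_eqE /= => ->.
rewrite (minor_mul_shear _ _ _ _ (incr_inj incg) gp).
have [q /eqP gq|noc] := pickP (fun q => g q == c').
  rewrite (minor_replace_eq0 _ _ _ gq) ?mulr0 ?addr0; last first.
    by rewrite gp -val_eqE /= -cc' neq_ltn ltnSn.
  by split=> //; rewrite lower_interval_away //; right; exists q; rewrite gq.
have incr' : incr [eta g with p |-> c'].
  by apply: (incr_replace (or_intror cc') incg gp) => i; rewrite noc.
have [P0' Ppos'] := suppf _ incr'.
split; first by rewrite addr_ge0 // mulr_ge0 // ltW.
rewrite (lower_interval_at (g' := fun i => [eta g with p |-> c'] i) incl incg' lofhi (p := p)).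
- rewrite -Ppos -Ppos'; split=> [|[]].
  + rewrite lt0r => /andP[]; case: (eqVneq (\det (mxsub f g M)) 0) => [->|? _ _].
      rewrite add0r mulf_eq0 negb_or => /andP[_ P'n] _; right.
      by rewrite lt0r P'n.
    by left; rewrite lt0r P0 andbT.
  + by move=> P; rewrite ltr_wpDr // mulr_ge0 // ltW.
  + by move=> P; rewrite ltr_wpDl // mulr_gt0.
- by rewrite gp.
- by rewrite /= eqxx.
- by move=> i /= /negbTE ->.
Qed.

Lemma interval_support_diag M Q (d : 'rV[R]_n) : (forall i, 0 < d ord0 i) ->
  interval_support M Q -> interval_support (M *m diag_mx d) Q.
Proof.
move=> d0 suppM f incf; have [lo [incl lof suppf]] := suppM f incf.
exists lo; split=> // g incg; have [P0 Ppos] := suppf g incg.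
have -> : mxsub f g (M *m diag_mx d)
    = mxsub f g M *m diag_mx (\row_j d ord0 (g j)).
  by rewrite !mul_mx_diag; apply/matrixP=> i j; rewrite !mxE.
have D0 : 0 < \det (diag_mx (\row_j d ord0 (g j))).
  by rewrite det_diag prodr_gt0 // => i _; rewrite mxE.
by rewrite det_mulmx pmulr_lge0 // pmulr_lgt0.
Qed.

End IntervalSupport.

(** * Positivity of all minors of a given order *)

Section WordSupport.
Local Open Scope ring_scope.
Variables (R : realType) (n k : nat).
Implicit Types (M : 'M[R]_n) (Q : seq nat) (w : seq (nat * R)).

Definition support_word w := [seq x.1 | x <- w & 0 < x.2].

Definition proper_word w := nonneg w && all (fun a => 0 < a < n)%N (map fst w).

Lemma interval_support_word_mx M Q w : proper_word w ->
  interval_support k M Q -> interval_support k (M *m word_mx n w) (Q ++ support_word w).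
Proof.
elim: w M Q => [|[a t] w IH] M Q.
  by rewrite mulmx1 cats0.
rewrite /proper_word /= => /andP[/andP[t0 w0] /andP[/andP[a0 an] wn]] suppM.
have pw : proper_word w by apply/andP.
have pan : (a.-1 < n)%N by apply: leq_ltn_trans an; apply: leq_pred.
pose c := Ordinal pan; pose c' := Ordinal an.
have cc' : c.+1 = c' :> nat by rewrite /= prednK.
rewrite mulmxA -[a]/(c' : nat) (letter_mx_shear _ cc') /support_word /=.
move: t0; rewrite le0r => /orP[/eqP ->|t0].
  by rewrite ltxx /shear scale0r addr0 mulmx1; apply: IH.
rewrite t0 -cat_rcons; apply: IH => //; exact: interval_support_up.
Qed.

Lemma interval_support_word_mx_tr M Q w : proper_word w ->
  interval_support k M Q -> interval_support k (M *m (word_mx n w)^T) Q.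
Proof.
elim: w M Q => [|[a t] w IH] M Q.
  by rewrite trmx1 mulmx1.
rewrite /proper_word /= => /andP[/andP[t0 w0] /andP[/andP[a0 an] wn]] suppM.
have pw : proper_word w by apply/andP.
have pan : (a.-1 < n)%N by apply: leq_ltn_trans an; apply: leq_pred.
pose c := Ordinal pan; pose c' := Ordinal an.
have cc' : c.+1 = c' :> nat by rewrite /= prednK.
rewrite trmx_mul mulmxA -[a]/(c' : nat) (letter_mx_shear _ cc') tr_shear.
by apply: interval_support_down => //; apply: IH.
Qed.

(** Both triangular factors are given by upper words, so that transposition
    exchanges the two words. *)
Definition udu wy (d : 'rV[R]_n) wx := (word_mx n wy)^T *m diag_mx d *m word_mx n wx.

Lemma tr_udu wy (d : 'rV[R]_n) wx : (udu wy d wx)^T = udu wx d wy.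
Proof. by rewrite /udu !trmx_mul trmxK tr_diag_mx mulmxA. Qed.

Definition repeat_word m Q := iter m (cat^~ Q) [::].

Lemma interval_support_udu_exp wy (d : 'rV[R]_n) wx m :
  proper_word wy -> proper_word wx -> (forall i, 0 < d ord0 i) ->
  interval_support k (udu wy d wx ^+ m) (repeat_word m (support_word wx)).
Proof.
move=> py px d0; elim: m => [|m IH] /=; first exact: interval_support1.
rewrite exprSr -[_ * _]/(_ *m _) /udu !mulmxA.
apply: interval_support_word_mx => //; apply: interval_support_diag => //.
exact: interval_support_word_mx_tr.
Qed.

(** The upper end reached from the lowest index set lies above the highest one;
    n - k + i is the zero-based i-th element of the latter. *)
Definition reaches_top Q :=
  forall i : 'I_k, (n - k + i < raises (fun i : 'I_k => i.+1) Q i)%N.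

(** The two corner minors decide: the upper end for the lowest rows is maximal,
    hence maximal for all rows by monotonicity; applied to the transpose this
    makes every minor with the lowest columns positive, so every lower end is
    minimal too. *)
Lemma minors_gt0_reaches M Q Q' : (k <= n)%N ->
  interval_support k M Q -> interval_support k M^T Q' ->
  minors_gt0 k M <-> reaches_top Q /\ reaches_top Q'.
Proof.
move=> kn suppM suppMt.
have minor_tr (B : 'M[R]_n) f g : \det (mxsub f g B^T) = \det (mxsub g f B).
  by rewrite -det_tr; congr (\det _); apply/matrixP=> i j; rewrite !mxE.
pose low : 'I_k -> 'I_n := widen_ord kn.
have high_proof (i : 'I_k) : (n - k + i < n)%N.
  by rewrite -[X in (_ < X)%N](subnK kn) ltn_add2l.
pose high i := Ordinal (high_proof i).
have inclow : incr low by [].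
have inchigh : incr high by move=> i j ij /=; rewrite ltn_add2l.
have incS : {homo (fun i : 'I_k => i.+1) : i j / (i < j)%N} by move=> i j ij.
have incr_ge_id (f : 'I_k -> 'I_n) : incr f -> forall i : 'I_k, (i <= f i)%N.
  move=> incf [i ik] /=; elim: i ik => // i IH ik.
  have ik' := ltnW ik; apply: leq_ltn_trans (IH ik') _; exact: incf.
have incr_le_high (f : 'I_k -> 'I_n) : incr f -> forall i : 'I_k, (f i <= n - k + i)%N.
  move=> incf i; have gap m (mk : (i + m < k)%N) : (f i + m <= f (Ordinal mk))%N.
    elim: m mk => [|m IH] mk.
      by rewrite addn0 (_ : Ordinal mk = i) //; apply/ord_inj; rewrite /= addn0.
    have mk' : (i + m < k)%N by apply: leq_trans mk; rewrite addnS.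
    by rewrite addnS; apply: leq_ltn_trans (IH mk') _; apply: incf; rewrite /= addnS.
  have ik := ltn_ord i.
  have mk : (i + (k.-1 - i) < k)%N by lia.
  have := gap _ mk; have := ltn_ord (f (Ordinal mk)); lia.
split=> [pos|[top top']].
  split=> i.
    have [lo [_ _ /(_ high inchigh)[_ [/(_ (pos _ _ inclow inchigh)) H _]]]] :=
      suppM low inclow.
    by case/andP: (H i).
  have [lo [_ _ /(_ high inchigh)[_ [H _]]]] := suppMt low inclow.
  rewrite minor_tr in H.
  by case/andP: (H (pos _ _ inchigh inclow) i).
have above (Q0 : seq nat) (f g : 'I_k -> 'I_n) : incr f -> incr g ->
    reaches_top Q0 -> forall i, (g i < raises (fun i => (f i).+1) Q0 i)%N.
  move=> incf incg topQ i; apply: leq_ltn_trans (incr_le_high g incg i) _.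
  apply: leq_trans (topQ i) _; apply: raises_mono => // j.
  by rewrite ltnS incr_ge_id.
move=> f g incf incg.
have [lo [inclo lof suppf]] := suppM f incf.
have lo_low i : (lo i <= low i)%N.
  have [_ [+ _]] := suppf low inclow.
  have [lo' [_ lo'low /(_ f incf)[_ [_]]]] := suppMt low inclow.
  rewrite minor_tr => Hpos Hlow; suff /Hlow/(_ i)/andP[] : 0 < \det (mxsub f low M) by [].
  apply: Hpos => j; rewrite above // andbT.
  exact: leq_trans (lo'low j) (incr_ge_id f incf j).
have [_ [_]] := suppf g incg; apply=> i; rewrite above // andbT.
exact: leq_trans (lo_low i) (incr_ge_id g incg i).
Qed.

End WordSupport.

(** * Passes on finite sets of labels *)

Section Sets.
Local Open Scope fset_scope.

(** The link with sets of labels: an increasing map stands for its image. *)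
Definition image_set k (h : 'I_k -> nat) : {fset nat} := [fset x in codom h].

Lemma in_image_set k (h : 'I_k -> nat) x :
  reflect (exists i, h i = x) (x \in image_set h).
Proof.
rewrite in_fset /=; apply: (iffP codomP) => [[i ->]|[i <-]]; by exists i.
Qed.

Lemma image_raise k (h : 'I_k -> nat) a : {homo h : i j / i < j} ->
  raise_at a (image_set h) = image_set (raise a h).
Proof.
move=> inch; rewrite /raise_at; apply/fsetP => x.
case: ifP => [/andP[/in_image_set[p hp] na]|no].
  have na' : [forall j, h j != a.+1].
    by apply/forallP=> j; apply: contraNneq na => hj; apply/in_image_set; exists j.
  rewrite in_fset1U in_fsetD1; apply/orP/in_image_set => [[/eqP ->|]|[i <-]].
  - by exists p; rewrite /raise hp eqxx na'.
  - by case/andP=> xa /in_image_set[i hi]; exists i; rewrite /raise hi (negbTE xa).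
  rewrite /raise na' andbT; case: (eqVneq (h i) a) => [_|hia]; first by left.
  by right; rewrite hia /=; apply/in_image_set; exists i.
have raiseE i : raise a h i = h i.
  rewrite /raise; case: ifP => // /andP[/eqP hi /forallP na]; case/negP: no.
  apply/andP; split; first by apply/in_image_set; exists i.
  by apply/negP => /in_image_set[j hj]; have := na j; rewrite hj eqxx.
by apply/in_image_set/in_image_set => -[i <-]; exists i.
Qed.

Lemma image_raises k (h : 'I_k -> nat) Q : {homo h : i j / i < j} ->
  pass Q (image_set h) = image_set (raises h Q).
Proof.
elim: Q h => //= a Q IH h inch.
by rewrite /pass /= image_raise // -/(pass _ _) IH //; apply: raise_incr.
Qed.

Lemma iter_pass m Q I : iter m (pass Q) I = pass (repeat_word m Q) I.
Proof. by elim: m => //= m ->; rewrite /pass foldl_cat. Qed.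

Lemma raises_le n k (h : 'I_k -> nat) Q : all (fun a => a < n) Q ->
  (forall i, h i <= n) -> forall i, raises h Q i <= n.
Proof.
elim: Q h => //= a Q IH h /andP[an Qn] hn; apply: IH => // i.
by rewrite /raise; case: ifP.
Qed.

Lemma all_repeat_word (p : pred nat) m Q : all p Q -> all p (repeat_word m Q).
Proof. by move=> pQ; elim: m => //= m IH; rewrite all_cat IH pQ. Qed.

Lemma reaches_top_pass n k Q m : k <= n -> all (fun a => a < n) Q ->
  reaches_top n k (repeat_word m Q) <-> iter m (pass Q) (lowest k) = highest n k.
Proof.
move=> kn Qn; pose S (i : 'I_k) := i.+1.
have incS : {homo S : i j / i < j} by [].
have -> : lowest k = image_set S.
  apply/fsetP=> x; rewrite in_fset /= mem_iota add1n ltnS.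
  apply/andP/in_image_set => [[x0 xk]|[i <-]]; last by rewrite ltn_ord.
  have xk' : x.-1 < k by rewrite prednK.
  by exists (Ordinal xk'); rewrite /S /= prednK.
rewrite iter_pass image_raises //.
set h := raises S _.
have inch : {homo h : i j / i < j} by apply: raises_incr.
have hn i : h i <= n.
  apply: raises_le; first exact: all_repeat_word.
  by move=> j; exact: leq_trans (ltn_ord j) kn.
have gap (i j : 'I_k) : i <= j -> h i + (j - i) <= h j.
  move=> ij; rewrite -(subnKC ij); move: (j - i) (subnKC ij) => d.
  rewrite addKn => dj; elim: d j dj {ij} => [|d IH] j dj.
    by rewrite addn0 (_ : i = j) //; apply/ord_inj; rewrite -dj addn0.
  have dk : i + d < k by apply: leq_trans (ltn_ord j); rewrite -dj addnS.
  rewrite addnS; apply: leq_ltn_trans (IH (Ordinal dk) erefl) _.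
  by apply: inch; rewrite /= -dj addnS.
have mem_high x : (x \in highest n k) = (n - k < x <= n).
  by rewrite in_fset /= mem_iota addSn subnK.
split=> [top|hE i].
  have hi i : h i = (n - k + i).+1.
    apply/eqP; rewrite eqn_leq top andbT.
    have ik := ltn_ord i; have jk : k.-1 < k by lia.
    have := gap i (Ordinal jk) _; have := hn (Ordinal jk) => /=; lia.
  apply/fsetP=> x; rewrite mem_high; apply/in_image_set/andP => [[i <-]|[x0 xn]].
    by rewrite hi; have := ltn_ord i; lia.
  have xk : x - (n - k).+1 < k by lia.
  by exists (Ordinal xk); rewrite hi /=; lia.
have ik := ltn_ord i; have k0 : 0 < k by lia.
have : h (Ordinal k0) \in highest n k by rewrite -hE; apply/in_image_set; eexists.
rewrite mem_high => /andP[h0 _]; have := gap (Ordinal k0) i (leq0n _).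
by rewrite /= -/h -/S; lia.
Qed.

Lemma pass_lowest_fixed a Q : a \notin Q -> pass Q (lowest a) = lowest a.
Proof.
elim: Q => //= b Q IH; rewrite inE negb_or => /andP[ab aQ].
rewrite /pass /= -/(pass _ _) -[in RHS](IH aQ) //; congr pass.
rewrite /raise_at ifF //; apply/negbTE; rewrite !in_fset /= !mem_iota.
by rewrite add1n; lia.
Qed.

End Sets.

(** * Least elements of upward closed properties *)

Section Least.

Lemma leastN (P : nat -> Prop) : (forall m, ~ P m) -> least P = None.
Proof.
by move=> nP; case E: (least P) => [m|//]; case/leastP: E => /nP.
Qed.

Lemma least_exists (P : nat -> Prop) m : P m -> exists a, least P = Some a.
Proof.
move=> Pm; rewrite /least; case: pselect => [?|n]; first by eexists.
by case: n; exists m; apply/asboolP.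
Qed.

Lemma least_ext (P Q : nat -> Prop) : (forall m, P m <-> Q m) -> least P = least Q.
Proof. by move=> PQ; congr least; apply/funext=> m; apply/propext. Qed.

Lemma least_and (P Q : nat -> Prop) :
  (forall m m', m <= m' -> P m -> P m') -> (forall m m', m <= m' -> Q m -> Q m') ->
  least (fun m => P m /\ Q m) = omax (least P) (least Q).
Proof.
move=> upP upQ; case EP: (least P) => [a|]; last first.
  by apply: leastN => m [Pm _]; have [b] := least_exists Pm; rewrite EP.
case EQ: (least Q) => [b|]; last first.
  by apply: leastN => m [_ Qm]; have [c] := least_exists Qm; rewrite EQ.
case/leastP: EP => Pa mina; case/leastP: EQ => Qb minb.
apply/leastP; split=> [|m [Pm Qm]]; last by rewrite geq_max mina ?minb.
by split; [apply: upP Pa; apply: leq_maxl|apply: upQ Qb; apply: leq_maxr].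
Qed.

End Least.

(** * Exponent profiles of factored matrices *)

Section Profile.
Local Open Scope ring_scope.
Variables (R : realType) (n : nat) (wy wx : seq (nat * R)) (d : 'rV[R]_n).
Hypotheses (py : proper_word n wy) (px : proper_word n wx).
Hypothesis d_gt0 : forall i, 0 < d ord0 i.

Let A := udu wy d wx.

Lemma trmx_exp (M : 'M[R]_n) m : (M ^+ m)^T = M^T ^+ m.
Proof.
elim: m => [|m IH]; first exact: trmx1.
by rewrite exprS exprSr -IH; apply: trmx_mul.
Qed.

Lemma TN_udu : totally_nonnegative A.
Proof.
move=> k f g incf incg; rewrite -[A]expr1.
have [lo [_ _ /(_ g incg)[]]] := interval_support_udu_exp (k := k) 1 py px d_gt0 incf.
by [].
Qed.

Lemma support_word_lt (w : seq (nat * R)) : proper_word n w ->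
  all (fun a => a < n)%N (support_word w).
Proof.
case/andP=> _ /allP wn; apply/allP => a /mapP[x]; rewrite mem_filter.
by case/andP=> _ xw ->; case/andP: (wn _ (map_f fst xw)).
Qed.

Lemma minors_gt0_udu_exp k m : (k <= n)%N ->
  minors_gt0 k (A ^+ m) <->
  iter m (pass (support_word wx)) (lowest k) = highest n k /\
  iter m (pass (support_word wy)) (lowest k) = highest n k.
Proof.
move=> kn; rewrite -!reaches_top_pass ?support_word_lt //.
apply: minors_gt0_reaches => //; first exact: interval_support_udu_exp.
by rewrite trmx_exp tr_udu; apply: interval_support_udu_exp.
Qed.

Lemma pass_top_stable k Q m m' : (k <= n)%N -> all (fun a => a < n)%N Q ->
  (m <= m')%N -> iter m (pass Q) (lowest k) = highest n k ->
  iter m' (pass Q) (lowest k) = highest n k.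
Proof.
move=> kn Qn /subnKC <-; rewrite -!reaches_top_pass // => top.
elim: (m' - m)%N => [|e IH]; first by rewrite addn0.
by rewrite addnS => i; rewrite /= raises_cat; apply: leq_trans (IH i) (raises_ge _ _ _).
Qed.

Lemma minor_exponent_udu k : (k <= n)%N ->
  minor_exponent k A =
  omax (passage_time n k (support_word wx)) (passage_time n k (support_word wy)).
Proof.
move=> kn; rewrite /passage_time -least_and.
- by apply: least_ext => m; rewrite minors_gt0_udu_exp //; tauto.
- move=> m m' mm [m0 top]; split; first exact: leq_trans mm.
  by apply: pass_top_stable mm top => //; apply: support_word_lt.
- move=> m m' mm [m0 top]; split; first exact: leq_trans mm.
  by apply: pass_top_stable mm top => //; apply: support_word_lt.
Qed.

End Profile.

Lemma passage_time_full n Q : all (fun a => a < n) Q -> passage_time n n Q = Some 1.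
Proof.
move=> /allP Qn; have nQ : n \notin Q by apply/negP => /Qn; rewrite ltnn.
apply/leastP; split; last by move=> m [].
by split=> //=; rewrite pass_lowest_fixed // /highest subnn.
Qed.

(** Without the letter a, the set L_a never moves. *)
Lemma complete_of_passage n Q :
  (forall k, 0 < k < n -> passage_time n k Q <> None) -> complete n Q.
Proof.
move=> fin; apply/allP=> a; rewrite mem_iota add1n => /andP[a0 an].
apply/negPn/negP => aQ; apply: (fin a); first by lia.
apply: leastN => m [_]; have -> : iter m (pass Q) (lowest a) = lowest a.
  by elim: m => //= m ->; apply: pass_lowest_fixed.
move/fsetP/(_ 1); rewrite !in_fset /= !mem_iota; lia.
Qed.

Theorem theorem7p7 (R : realType) (n : nat) (f : 'I_n -> nat)
    (n_ge2 : 2 <= n) (f_gt0 : forall i : 'I_n, 0 < f i) :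
  (exists A : 'M[R]_n, oscillatory A /\ is_exponent_profile f A)
  <->
  ((forall i : 'I_n, i.+1 = n -> f i = 1) /\
   exists Qp Qm : seq nat,
     [/\ Qp \in complete_subword n,
         Qm \in complete_subword n
       & forall i : 'I_n, i.+1 < n ->
           Some (f i)
             = omax (passage_time n i.+1 Qp) (passage_time n i.+1 Qm)]).
Proof.
split=> [[A [[TNA [m [m0 TPm]]] prof]]|[fn [Qp [Qm [Qp_in Qm_in fE]]]]].
  have detA : (\det A != 0)%R.
    have : (0 < \det (mxsub id id (A ^+ m)))%R by apply: TPm.
    have -> : mxsub id id (A ^+ m)%R = (A ^+ m)%R by apply/matrixP=> i j; rewrite mxE.
    apply: contraTneq => dA; rewrite -(prednK m0) exprS.
    by rewrite -[(_ * _)%R]/(_ *m _)%R det_mulmx dA mul0r ltxx.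
  have [wx [wy [d [[wxi wyi wx0 wy0] [d0 EA]]]]] := TN_factorization TNA detA.
  have proper (w : seq (nat * R)) : map fst w = Omega n -> nonneg w -> proper_word n w.
    by move=> wi w0; rewrite /proper_word w0 wi; apply/allP => a /Omega_letter.
  have px := proper _ wxi wx0; have py := proper _ wyi wy0.
  have expE (i : 'I_n) := minor_exponent_udu py px d0 (ltn_ord i).
  have subw (w : seq (nat * R)) : map fst w = Omega n -> subseq (support_word w) (Omega n).
    by move=> <-; apply/map_subseq/filter_subseq.
  have fE (i : 'I_n) : Some (f i) = omax (passage_time n i.+1 (support_word wx))
      (passage_time n i.+1 (support_word wy)).
    by rewrite -expE -(prof i) EA.
  split=> [i i_n|].
    by have := fE i; rewrite i_n !passage_time_full ?support_word_lt // => -[].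
  exists (support_word wx), (support_word wy).
  have idx k : 0 < k < n -> exists i : 'I_n, i.+1 = k.
    move=> /andP[k0 kn]; have ki : k.-1 < n by lia.
    by exists (Ordinal ki); rewrite /= prednK.
  split=> //; rewrite inE subw //=; apply: complete_of_passage => k /idx[i <-] none.
    by have := fE i; rewrite none.
  by have := fE i; rewrite none; case: passage_time.
(* Any positive parameters would do; 1 is the simplest choice. *)
pose word (Q : seq nat) : seq (nat * R) := map (fun a => (a, 1%R)) Q.
have support_wordE Q : support_word (word Q) = Q.
  by elim: Q => //= a Q IH; rewrite /support_word /= ltr01 /= -[in RHS]IH.
have proper Q : Q \in complete_subword n -> proper_word n (word Q).
  case/andP=> sub _; apply/andP; split.
    by apply/allP=> x /mapP[a _ ->]; apply: ler01.
  rewrite -map_comp map_id; apply/allP => a aQ; apply: Omega_letter.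
  exact: mem_subseq sub _ aQ.
have py := proper _ Qm_in; have px := proper _ Qp_in.
pose d : 'rV[R]_n := const_mx 1%R.
have d0 i : (0 < d ord0 i)%R by rewrite mxE ltr01.
pose A := udu (word Qm) d (word Qp).
have prof : is_exponent_profile f A.
  move=> i; rewrite (minor_exponent_udu py px d0) ?ltn_ord // !support_wordE.
  have := ltn_ord i; rewrite leq_eqVlt => /orP[/eqP i_n|/fE //].
  by rewrite i_n !passage_time_full ?fn // -[X in all _ X]support_wordE support_word_lt.
exists A; split=> //; split; first exact: TN_udu.
exists (\max_i f i).+1; split=> // k g h incg inch.
have kn : k <= n.
  by rewrite -[k]card_ord -[n]card_ord; apply: leq_card; apply: (@incr_inj _ _ g).
have := kn; case: (posnP k) => [k0 _|k0 ki].
  by move: g h incg inch; rewrite k0 => g h _ _; rewrite det_mx00 ltr01.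
have ki' : k.-1 < n by lia.
have kE : (Ordinal ki').+1 = k by rewrite /= prednK.
have := prof (Ordinal ki'); rewrite kE => /leastP[[_ pos] _].
have := minors_gt0_udu_exp py px d0 (\max_i f i).+1 kn.
case=> _; apply=> //.
have [tp tm] := (minors_gt0_udu_exp py px d0 (f (Ordinal ki')) kn).1 pos.
have le_max : f (Ordinal ki') <= (\max_i f i).+1.
  by apply: leqW; apply: leq_bigmax.
by split; [apply: pass_top_stable le_max tp|apply: pass_top_stable le_max tm] => //;
  apply: support_word_lt.
Qed.
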